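(* Let $(W,S)$ be a Coxeter system with $S$ finite, let $x\in W$ and let $\beta\in\Phi(x)$. If there exists $y\in W$ such that $$\Phi(x)\cap\Phi(y)=\{\beta\},$$ then there exists a unique element $y_\beta\in W$ of minimal length with this property, i.e. among all $y\in W$ satisfying $\Phi(x)\cap\Phi(y)=\{\beta\}$ there is exactly one of minimal length.
   Context: $(W,S)$ is a Coxeter system with $S$ finite and $\ell$ is the word length with respect to $S$. $V$ is the real vector space with basis $\{\alpha_s\mid s\in S\}$ and symmetric bilinear form $\langle\alpha_s,\alpha_t\rangle=-\cos(\pi/m(s,t))$ (equal to $-1$ if $m(s,t)=\infty$); $W$ acts on $V$ by $sv=v-2\langle v,\alpha_s\rangle\alpha_s$. The root system is $\Phi=\{w\alpha_s\mid w\in W,s\in S\}=\Phi^+\sqcup\Phi^-$, where $\Phi^+$ (resp. $\Phi^-$) consists of roots that are non-negative (resp. non-positive) combinations of the $\alpha_s$. The (left) inversion set of $w\in W$ is $\Phi(w)=\{\alpha\in\Phi^+\mid w^{-1}\alpha\in\Phi^-\}$. *)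

(* Defs.v *)
From HB Require Import structures.
From mathcomp Require Import all_boot all_order all_algebra.
From mathcomp Require Import ring.
From mathcomp Require Import all_classical all_reals all_analysis.

Set Implicit Arguments.
Unset Strict Implicit.
Unset Printing Implicit Defensive.

Import Order.TTheory GRing.Theory Num.Theory.

Local Open Scope classical_set_scope.
Local Open Scope ring_scope.

(* A Coxeter system: [W] has the presentation                                *)
(*     < S | (s t)^m(s,t) = 1 for all s, t with m(s,t) finite >.             *)
(* The generating set is given as a finite type [S] with a map to [W] (the   *)
(* map is injective as a consequence of the presentation).                   *)
(* The value [cox_m s t = 0] encodes m(s,t) = oo; the corresponding relation *)
(* then reads 1 = 1.  As the generators are involutions, words in [S] (with  *)
(* no formal inverses) suffice to express generation.                        *)
Record coxeter_system (W : groupType) (S : finType) := CoxeterSystem {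
  cox_m : S -> S -> nat;
  cox_gen : S -> W;
  cox_m_diag : forall s, cox_m s s = 1%N;
  cox_m_sym : forall s t, cox_m s t = cox_m t s;
  cox_m_neq1 : forall s t, s != t -> cox_m s t != 1%N;
  cox_rel : forall s t, ((cox_gen s * cox_gen t) ^+ cox_m s t = 1)%g;
  cox_generate : forall w : W,
    exists r : seq S, (\prod_(s <- r) cox_gen s)%g = w;
  cox_lift : forall (G : groupType) (f : S -> G),
    (forall s t, ((f s * f t) ^+ cox_m s t = 1)%g) ->
    exists phi : {multiplicative W -> G}, forall s, phi (cox_gen s) = f s }.

Section Length.
Variables (W : groupType) (S : finType) (C : coxeter_system W S).

Definition has_word_of_size (w : W) (n : nat) : bool :=
  `[< exists r : seq S, size r = n /\ (\prod_(s <- r) cox_gen C s)%g = w >].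

Lemma has_word (w : W) : exists n, has_word_of_size w n.
Proof.
have [r rw] := cox_generate C w.
by exists (size r); apply/asboolP; exists r.
Qed.

Definition cox_length (w : W) : nat := ex_minn (has_word w).

End Length.

Section Bijections.
Variable T : Type.

Record bij := Bij {
  bij_fun :> T -> T;
  bij_inv : T -> T;
  bij_funK : cancel bij_fun bij_inv;
  bij_invK : cancel bij_inv bij_fun }.

HB.instance Definition _ := gen_eqMixin bij.
HB.instance Definition _ := gen_choiceMixin bij.

Lemma bijP (f g : bij) : f =1 g -> f = g.
Proof.
case: f g => [f f' fK f'K] [g g' gK g'K] /= /funext fg; subst g.
have e : f' = g' by apply/funext => x; rewrite -[x in LHS]g'K fK.
by subst g'; congr Bij; exact: Prop_irrelevance.
Qed.

Definition bij1 := @Bij id id (fun=> erefl) (fun=> erefl).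
Definition bijM (f g : bij) :=
  Bij (can_comp (bij_funK f) (bij_funK g)) (can_comp (bij_invK g) (bij_invK f)).
Definition bijV (f : bij) := Bij (bij_invK f) (bij_funK f).

Lemma bijA : associative bijM. Proof. by move=> f g h; exact: bijP. Qed.
Lemma bij1M : left_id bij1 bijM. Proof. by move=> f; exact: bijP. Qed.
Lemma bijM1 : right_id bij1 bijM. Proof. by move=> f; exact: bijP. Qed.
Lemma bijVM : left_inverse bij1 bijV bijM.
Proof. by move=> f; apply: bijP => x /=; rewrite bij_funK. Qed.
Lemma bijMV : right_inverse bij1 bijV bijM.
Proof. by move=> f; apply: bijP => x /=; rewrite bij_invK. Qed.

HB.instance Definition _ := isGroup.Build bij bijA bij1M bijM1 bijVM bijMV.

Lemma bij_expE (f : bij) n x : (f ^+ n)%g x = iter n f x.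
Proof. by elim: n x => [//|n IH] x; rewrite expgS /= IH. Qed.

End Bijections.

Section GeometricRepresentation.
Variables (R : realType) (W : groupType) (S : finType) (C : coxeter_system W S).

(* The vector space V, with basis the simple roots; the coordinates of       *)
(* [v : V] on this basis are its values [v s].                               *)
Local Notation V := {ffun S -> R^o}.

Definition simple_root (s : S) : V := [ffun t => (t == s)%:R].

Definition gram (s t : S) : R :=
  if cox_m C s t == 0%N then -1 else - cos (pi / (cox_m C s t)%:R).

Definition form (u v : V) : R := \sum_s \sum_t u s * v t * gram s t.

Definition simple_refl (s : S) (v : V) : V :=
  v - (2 * form v (simple_root s)) *: simple_root s.

Lemma gramC s t : gram s t = gram t s.
Proof. by rewrite /gram cox_m_sym. Qed.

Lemma gramss s : gram s s = 1.
Proof. by rewrite /gram cox_m_diag /= divr1 cospi opprK. Qed.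

Lemma formC u v : form u v = form v u.
Proof.
rewrite /form exchange_big; apply: eq_bigr => s _; apply: eq_bigr => t _.
by rewrite gramC [u _ * _]mulrC.
Qed.

Lemma formDl u u' v : form (u + u') v = form u v + form u' v.
Proof.
rewrite /form -big_split; apply: eq_bigr => s _; rewrite -big_split.
by apply: eq_bigr => t _; rewrite /= !ffunE !mulrDl.
Qed.

Lemma formZl a u v : form (a *: u) v = a * form u v.
Proof.
rewrite /form mulr_sumr; apply: eq_bigr => s _; rewrite mulr_sumr.
by apply: eq_bigr => t _; rewrite !ffunE -!mulrA.
Qed.

Lemma form_simple s t : form (simple_root s) (simple_root t) = gram s t.
Proof.
rewrite /form (bigD1 s)//= [X in _ + X]big1 ?addr0; last first.
  by move=> i /negPf si; rewrite big1// => j _; rewrite ffunE si !mul0r.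
rewrite (bigD1 t)//= big1 ?addr0; first by rewrite !ffunE !eqxx !mul1r.
by move=> j /negPf tj; rewrite [simple_root t j]ffunE tj mulr0 mul0r.
Qed.

Lemma form_refl s t v : form (simple_refl s v) (simple_root t) =
  form v (simple_root t) - 2 * form v (simple_root s) * gram s t.
Proof. by rewrite /simple_refl formDl -scaleNr formZl form_simple mulNr. Qed.

Lemma simple_reflK s : involutive (simple_refl s).
Proof.
move=> v; rewrite {1}/simple_refl form_refl gramss /simple_refl -addrA.
rewrite -opprD -scalerDl [X in X *: _](_ : _ = 0) ?scale0r ?subr0//.
by ring.
Qed.

Lemma simple_refl_braid s t v :
  iter (cox_m C s t) (simple_refl s \o simple_refl t) v = v.
Proof.
have [<-|st] := eqVneq s t.
  by elim: (cox_m _ _ _) => //= n ->; rewrite simple_reflK.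
have [/eqP m0|m0] := boolP (cox_m C s t == 0%N); first by rewrite m0.
set m := cox_m C s t in m0 *; set th : R := pi / m%:R.
have m2 : (1 < m)%N.
  by rewrite ltn_neqAle lt0n m0 andbT eq_sym; exact: cox_m_neq1.
have gst : gram s t = - cos th by rewrite /gram -/m (negPf m0).
have gts : gram t s = - cos th by rewrite gramC.
have mR : m%:R != 0 :> R by rewrite pnatr_eq0.
have sth : sin th != 0.
  apply/lt0r_neq0/sin_gt0_pi; rewrite divr_gt0 ?pi_gt0 ?ltr0n ?lt0n//=.
  by rewrite ltr_pdivrMr ?ltr0n ?lt0n// ltr_pMr ?pi_gt0// ltr1n.
set a0 := form v (simple_root s); set b0 := form v (simple_root t).
have cs : sin th ^+ 2 = 1 - cos th ^+ 2 by exact: sin2cos2.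
have key k : exists x y : R,
  let z := iter k (simple_refl s \o simple_refl t) v in
  let uu := sin (th *+ 2 *+ k) in let ww := cos (th *+ 2 *+ k) in
  [/\ z = v + (x *: simple_root s + y *: simple_root t),
      form z (simple_root s) * sin th =
        - a0 * (uu * cos th - ww * sin th) - b0 * uu &
      form z (simple_root t) * sin th =
        a0 * uu + b0 * (uu * cos th + ww * sin th)].
  elim: k => [|k [x [y /= [zE zs zt]]]].
    exists 0, 0; rewrite /= !mulr0n sin0 cos0 !scale0r !addr0.
    by split=> //; rewrite -/a0 -/b0; ring.
  move: (iter k _ v) zE zs zt => z zE zs zt.
  exists (x - 2 * form (simple_refl t z) (simple_root s)),
         (y - 2 * form z (simple_root t)).
  rewrite /= [_ *+ k.+1]mulrSr [sin (_ + _)]sinD [cos (_ *+ k + _)]cosD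
    sin_mulr2n cos_mulr2n; split.
  - rewrite {1}/simple_refl {1}/simple_refl zE !scalerBl.
    by apply/ffunP => i; rewrite !ffunE; ring.
  - rewrite !form_refl !gramss ?gst ?gts.
    set fs := form z _ in zs *; set ft := form z _ in zt *.
    set u := sin (_ *+ k) in zs zt *; set w := cos (_ *+ k) in zs zt *.
    have -> : (fs - 2 * ft * - cos th
       - 2 * (fs - 2 * ft * - cos th) * 1) * sin th =
       - (fs * sin th) - 2 * cos th * (ft * sin th) by ring.
    rewrite zs zt; ring: cs.
  - rewrite !form_refl !gramss ?gst ?gts.
    set fs := form z _ in zs *; set ft := form z _ in zt *.
    set u := sin (_ *+ k) in zs zt *; set w := cos (_ *+ k) in zs zt *.
    have -> : (ft - 2 * ft * 1
       - 2 * (fs - 2 * ft * - cos th) * - cos th) * sin th =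
       2 * cos th * (fs * sin th) + (4 * cos th ^+ 2 - 1) * (ft * sin th).
      by ring.
    rewrite zs zt; ring: cs.
have [x [y /= [zE zs zt]]] := key m.
have thm : th *+ 2 *+ m = pi *+ 2 by rewrite mulrnAC -[th *+ m]mulr_natr divfK.
rewrite thm sin2pi cos2pi in zs zt.
have fs : form (iter m (simple_refl s \o simple_refl t) v) (simple_root s) = a0.
  by apply: (mulIf sth); rewrite zs; ring.
have ft : form (iter m (simple_refl s \o simple_refl t) v) (simple_root t) = b0.
  by apply: (mulIf sth); rewrite zt; ring.
move: fs ft; rewrite zE !formDl !formZl !form_simple !gramss gst gts -/a0 -/b0.
move=> h1 h2.
have e1 : x - cos th * y = 0.
  by apply: (addrI a0); rewrite addr0 -[RHS]h1; ring.
have e2 : y - cos th * x = 0.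
  by apply: (addrI b0); rewrite addr0 -[RHS]h2; ring.
have s20 : sin th ^+ 2 != 0 by rewrite expf_neq0.
have x0 : x = 0.
  apply: (mulIf s20); rewrite mul0r cs.
  have -> : x * (1 - cos th ^+ 2) =
      (x - cos th * y) + cos th * (y - cos th * x) by ring.
  by rewrite e1 e2 mulr0 addr0.
have y0 : y = 0.
  apply: (mulIf s20); rewrite mul0r cs.
  have -> : y * (1 - cos th ^+ 2) =
      (y - cos th * x) + cos th * (x - cos th * y) by ring.
  by rewrite e1 e2 mulr0 addr0.
by rewrite x0 y0 !scale0r !addr0.
Qed.

Definition simple_refl_bij (s : S) : bij V :=
  Bij (simple_reflK s) (simple_reflK s).

Lemma geom_rep_exists : exists phi : {multiplicative W -> bij V},
  forall s, phi (cox_gen C s) = simple_refl_bij s.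
Proof.
apply: cox_lift => s t; apply: bijP => v.
by rewrite bij_expE; exact: simple_refl_braid.
Qed.

(* The action of [W] on [V]: by [cox_generate], the only one such that each  *)
(* generator [s] acts as [simple_refl s].                                    *)
Definition act (w : W) (v : V) : V := projT1 (cid geom_rep_exists) w v.

Lemma act_gen s v : act (cox_gen C s) v = simple_refl s v.
Proof. by rewrite /act; case: (cid _) => phi /= ->. Qed.

Lemma actM w w' v : act (w * w')%g v = act w (act w' v).
Proof. by rewrite /act gmulfM. Qed.

Lemma act1 v : act 1%g v = v.
Proof.
rewrite /act; case: (cid _) => phi /= _.
suff -> : phi 1%g = 1%g by [].
by apply: (mulgI (phi 1%g)); rewrite -gmulfM !mulg1.
Qed.

Definition roots : set V :=
  [set a | exists (w : W) (s : S), a = act w (simple_root s)].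

Definition pos_roots : set V := [set a | roots a /\ forall s, 0 <= a s].

Definition neg_roots : set V := [set a | roots a /\ forall s, a s <= 0].

Definition inversions (w : W) : set V :=
  [set a | pos_roots a /\ neg_roots (act w^-1%g a)].

End GeometricRepresentation.

(* Main.v *)
(* The elements y with Phi(x) & Phi(y) = {beta} are shown to be directed      *)
(* downwards for the weak order (inclusion of inversion sets), which gives    *)
(* the uniqueness because the length is strictly monotone.                    *)
(* Choose prefixes a s_r of x, y' s of y and z' t of z whose last inversion   *)
(* is beta = a alpha_r = y' alpha_s = z' alpha_t.  Then Phi(a) is disjoint    *)
(* from Phi(y') and Phi(z'), so a^-1 is a prefix of u = a^-1 y' and of        *)
(* v = a^-1 z', while u alpha_s = v alpha_t = alpha_r.  The meet m of u and v *)
(* inherits the last property: m alpha_p = alpha_r for some simple p.  This   *)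
(* is a form of the semidistributivity of the weak order, valid for infinite  *)
(* W as well.  Then a m is a prefix of y' and z' with a m alpha_p = beta, and *)
(* a m p is the wanted lower bound of y and z.                                *)

From HB Require Import structures.
From mathcomp Require Import all_boot all_order all_algebra.
From mathcomp Require Import ring zify.
From mathcomp Require Import all_classical all_reals all_analysis.
Require Import Defs.

Set Implicit Arguments.
Unset Strict Implicit.
Unset Printing Implicit Defensive.

Import Order.TTheory GRing.Theory Num.Theory.

Local Open Scope classical_set_scope.

(** The weak order is handled through roots. Every root has a sign ([root_nonneg], from
    [act_nonneg]), and so inclusion of inversion sets amounts to being a reduced prefix
    ([weak_le_length], [length_weak_le]). Common lower bounds of two elements are directed, so meets
    exist ([weak_meet]). [meet_gen_conj] is the semidistributivity step, and
    [intersection_set1_directed] derives from it a solution below any two solutions. If those two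
    have minimal length, all three coincide by [weak_le_eq]. *)

Section CoxeterLength.
Variables (W : groupType) (S : finType) (C : coxeter_system W S).
Local Open Scope group_scope.
Local Notation ell := (cox_length C).
Local Notation gen := (cox_gen C).

(** * Length, left descents and alternating words *)

Lemma cox_length_prod (r : seq S) : (ell (\prod_(s <- r) gen s) <= size r)%N.
Proof.
rewrite /cox_length; case: ex_minnP => n _; apply.
by apply/asboolP; exists r.
Qed.

Lemma reduced_word (w : W) :
  exists2 r : seq S, size r = ell w & \prod_(s <- r) gen s = w.
Proof.
rewrite /cox_length; case: ex_minnP => n /asboolP[r [rn rw]] _.
by exists r.
Qed.

Lemma cox_gen2 s : gen s * gen s = 1.
Proof. by have := cox_rel C s s; rewrite cox_m_diag expg1. Qed.

Lemma cox_genV s : (gen s)^-1 = gen s.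
Proof. by apply: (mulgI (gen s)); rewrite mulgV cox_gen2. Qed.

Lemma cox_genK s w : gen s * (gen s * w) = w.
Proof. by rewrite mulgA cox_gen2 mul1g. Qed.

Lemma cox_length1 : ell 1 = 0%N.
Proof.
by apply/eqP; rewrite -leqn0; have := cox_length_prod [::]; rewrite big_nil.
Qed.

Lemma cox_length0_eq1 w : ell w = 0%N -> w = 1.
Proof. by have [[|s r] <- <-] := reduced_word w; rewrite ?big_nil. Qed.

Lemma cox_lengthM a b : (ell (a * b) <= ell a + ell b)%N.
Proof.
have [r <- {1}<-] := reduced_word a; have [q <- {1}<-] := reduced_word b.
by rewrite -big_cat -size_cat; exact: cox_length_prod.
Qed.

Lemma cox_length_gen s : (ell (gen s) <= 1)%N.
Proof. by have := cox_length_prod [:: s]; rewrite big_seq1. Qed.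

Lemma cox_length_genM s w : (ell (gen s * w) <= (ell w).+1)%N.
Proof. by have := cox_lengthM (gen s) w; have := cox_length_gen s; lia. Qed.

Lemma cox_length_le_genM s w : (ell w <= (ell (gen s * w)).+1)%N.
Proof. by rewrite -{1}(cox_genK s w) cox_length_genM. Qed.

Lemma exists_left_descent w : w <> 1 -> exists s, ell w = (ell (gen s * w)).+1.
Proof.
have [[|s r] /= rw wE] := reduced_word w; first by rewrite -wE big_nil.
move=> _; exists s; have := cox_length_le_genM s w.
have := cox_length_prod r.
have -> : gen s * w = \prod_(t <- r) gen t by rewrite -wE big_cons cox_genK.
by lia.
Qed.

Lemma cox_length_ind (P : W -> Prop) : P 1 ->
  (forall s w, ell (gen s * w) = (ell w).+1 -> P w -> P (gen s * w)) ->
  forall w, P w.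
Proof.
move=> P1 PS w; have [n] := ubnP (ell w); elim: n w => // n IH w wn.
have [->//|/eqP/exists_left_descent[s sw]] := eqVneq w 1.
by rewrite -(cox_genK s w); apply: PS; rewrite ?cox_genK//; apply: IH; lia.
Qed.

Fixpoint alt (s t : S) (k : nat) : W :=
  if k is k'.+1 then gen s * alt t s k' else 1.

(** Letter number [k], counted from 0, of s t s t ...: the one that extends [alt s t k] on the
    right. *)
Definition alt_letter (s t : S) (k : nat) : S := if odd k then t else s.

Lemma alt_letterS s t k : alt_letter s t k.+1 = alt_letter t s k.
Proof. by rewrite /alt_letter /=; case: odd. Qed.

Lemma altD s t k j :
  alt s t (k + j) = alt s t k * alt (alt_letter s t k) (alt_letter t s k) j.
Proof.
elim: k s t => [|k IH] s t; first by rewrite mul1g.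
by rewrite addSn /= IH mulgA !alt_letterS.
Qed.

Lemma altSr s t k : alt s t k.+1 = alt s t k * gen (alt_letter s t k).
Proof. by rewrite -addn1 altD /= mulg1. Qed.

Lemma altSrV_mul s t k w :
  (alt s t k.+1)^-1 * w = gen (alt_letter s t k) * ((alt s t k)^-1 * w).
Proof. by rewrite altSr invgM cox_genV mulgA. Qed.

Lemma cox_length_alt s t k : (ell (alt s t k) <= k)%N.
Proof.
elim: k s t => [|k IH] s t /=; first by rewrite cox_length1.
by rewrite (leq_trans (cox_length_genM _ _)) ?ltnS.
Qed.

Lemma alt_mulV s t k : alt s t k * (alt t s k)^-1 = (gen s * gen t) ^+ k.
Proof.
elim: k s t => [|k IH] s t /=; first by rewrite invg1 mulg1.
rewrite invgM cox_genV mulgA -[_ * _ / _]mulgA IH.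
elim: k {IH} => [|k IH]; first by rewrite mulg1.
by rewrite expgS [in RHS]expgS -IH !mulgA.
Qed.

Lemma alt_braid s t : alt s t (cox_m C s t) = alt t s (cox_m C s t).
Proof.
by apply: (mulIg (alt t s (cox_m C s t))^-1); rewrite alt_mulV cox_rel mulgV.
Qed.

End CoxeterLength.

Section RootSystem.
Variables (R : realType) (W : groupType) (S : finType).
Variable C : coxeter_system W S.
Local Open Scope ring_scope.
Local Notation V := {ffun S -> R^o}.
Local Notation ell := (cox_length C).
Local Notation gen := (cox_gen C).
Local Notation alpha := (@simple_root R S).
Local Notation act := (@Defs.act R W S C).
Local Notation form := (@Defs.form R W S C).
Local Notation roots := (@Defs.roots R W S C).
Local Notation Phi := (@inversions R W S C).
Implicit Types (u v : V) (s t : S) (w a b : W) (g : V).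

(** * The action on V is linear and preserves the form *)

Lemma form_addr v u u' : form v (u + u') = form v u + form v u'.
Proof. by rewrite formC formDl !(formC C v). Qed.

Lemma form_scaler k v u : form v (k *: u) = k * form v u.
Proof. by rewrite formC formZl (formC C v). Qed.

Lemma act_linear w k u v : act w (k *: u + v) = k *: act w u + act w v.
Proof.
have [r <-] := cox_generate C w; elim: r u v => [|s r IH] u v.
  by rewrite big_nil !act1.
rewrite big_cons !actM IH !act_gen /simple_refl formDl formZl.
by apply/ffunP => t; rewrite !ffunE /GRing.scale /=; ring.
Qed.

Lemma act0 w : act w 0 = 0.
Proof.
by have := act_linear w (-1) 0 0; rewrite scaler0 addr0 scaleN1r addNr.
Qed.

Lemma actD w u v : act w (u + v) = act w u + act w v.
Proof. by have := act_linear w 1 u v; rewrite !scale1r. Qed.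

Lemma actZ w k u : act w (k *: u) = k *: act w u.
Proof. by have := act_linear w k u 0; rewrite act0 !addr0. Qed.

Lemma actN w u : act w (- u) = - act w u.
Proof. by rewrite -scaleN1r actZ scaleN1r. Qed.

Lemma actK w u : act w^-1%g (act w u) = u.
Proof. by rewrite -actM mulVg act1. Qed.

Lemma actVK w u : act w (act w^-1%g u) = u.
Proof. by rewrite -actM mulgV act1. Qed.

Lemma form_act w u v : form (act w u) (act w v) = form u v.
Proof.
have [r <-] := cox_generate C w; elim: r => [|s r IH].
  by rewrite big_nil !act1.
rewrite big_cons !actM !act_gen -[RHS]IH.
move: (act _ u) (act _ v) => x y; rewrite /simple_refl.
have formB p q : form (x - p *: alpha s) (y - q *: alpha s) =
    form x y - q * form x (alpha s) - p * form y (alpha s) + p * q.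
  rewrite -[- (p *: _)]scaleNr -[- (q *: _)]scaleNr.
  rewrite !form_addr !formDl !form_scaler !formZl form_simple.
  by rewrite gramss (formC C (alpha s) y); ring.
by rewrite formB; ring.
Qed.

Lemma act_gen_simple s : act (gen s) (alpha s) = - alpha s.
Proof.
rewrite act_gen /simple_refl form_simple gramss mulr1.
by rewrite scaler_nat mulr2n opprD addNKr.
Qed.

Lemma simple_actK s v : act (gen s) (act (gen s) v) = v.
Proof. by rewrite -actM cox_gen2 act1. Qed.

Lemma actV_genM s w v : act (gen s * w)^-1%g v = act w^-1%g (act (gen s) v).
Proof. by rewrite invgM actM cox_genV. Qed.

Lemma roots_act w g : roots g -> roots (act w g).
Proof. by move=> [a [s ->]]; exists (w * a)%g, s; rewrite actM. Qed.

Lemma roots_simple s : roots (alpha s).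
Proof. by exists 1%g, s; rewrite act1. Qed.

Lemma rootsN g : roots g -> roots (- g).
Proof.
by move=> [w [s ->]]; exists (w * gen s)%g, s; rewrite actM act_gen_simple actN.
Qed.

Lemma form_root g : roots g -> form g g = 1.
Proof. by move=> [w [s ->]]; rewrite form_act form_simple gramss. Qed.

(** * Signs of roots, by way of rank two subgroups *)

Definition nonneg (v : V) : Prop := forall s, 0 <= v s.

Lemma nonneg_simple s : nonneg (alpha s).
Proof. by move=> t; rewrite ffunE ler0n. Qed.

Lemma nonneg_comb (p q : R) u v :
  0 <= p -> 0 <= q -> nonneg u -> nonneg v -> nonneg (p *: u + q *: v).
Proof.
by move=> p0 q0 u0 v0 s; rewrite !ffunE addr_ge0// mulr_ge0.
Qed.

(* The coefficients U_{k-1}(-gram s t), with U Chebyshev of the second kind;  *)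
(* the first case is the limit th -> 0 of sin (k th) / sin th.                *)
Definition dihedral_coef s t (k : nat) : R :=
  let m := cox_m C s t in
  if m == 0%N then k%:R else sin (pi / m%:R *+ k) / sin (pi / m%:R).

Section Dihedral.
Variables s t : S.
Hypothesis st : s != t.
Let m := cox_m C s t.
Let th : R := pi / m%:R.

Let sth : m != 0%N -> 0 < sin th.
Proof.
move=> m0; have m2 : (1 < m)%N.
  by rewrite ltn_neqAle lt0n m0 andbT eq_sym; exact: cox_m_neq1.
apply: sin_gt0_pi; rewrite divr_gt0 ?pi_gt0 ?ltr0n ?lt0n//=.
by rewrite ltr_pdivrMr ?ltr0n ?lt0n// ltr_pMr ?pi_gt0// ltr1n.
Qed.

(** For finite m(s,t), the angle k pi / m stays in [0, pi] as long as k <= m. *)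
Lemma dihedral_coef_ge0 k : m = 0%N \/ (k <= m)%N -> 0 <= dihedral_coef s t k.
Proof.
rewrite /dihedral_coef -/m -/th => km; case: eqP => [_|/eqP m0].
  exact: ler0n.
have {km} km : (k <= m)%N by case: km => // e; rewrite e in m0.
rewrite divr_ge0 ?(ltW (sth _))//; apply: sin_ge0_pi.
rewrite mulrn_wge0 ?divr_ge0 ?pi_ge0//= /th -mulr_natr mulrAC.
by rewrite ler_pdivrMr ?ltr0n ?lt0n// ler_pM2l ?pi_gt0// ler_nat.
Qed.

Lemma dihedral_coefSS k : dihedral_coef s t k.+2 =
  - (2 * gram R C s t) * dihedral_coef s t k.+1 - dihedral_coef s t k.
Proof.
rewrite /dihedral_coef /gram -/m -/th; case: eqP => [_|/eqP m0].
  by rewrite -addn2 -addn1 !natrD; ring.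
have sn0 : sin th != 0 by rewrite gt_eqF// sth.
rewrite !mulrSr 2!sinD cosD; set x := sin (th *+ k); set y := cos (th *+ k).
have cs : sin th ^+ 2 = 1 - cos th ^+ 2 by exact: sin2cos2.
apply: (mulIf sn0); rewrite [in RHS]mulrBl -[in RHS]mulrA !divfK//.
by ring: cs.
Qed.

Lemma dihedral_coef0 : dihedral_coef s t 0 = 0.
Proof. by rewrite /dihedral_coef; case: ifP; rewrite // mulr0n sin0 mul0r. Qed.

Lemma dihedral_coef1 : dihedral_coef s t 1 = 1.
Proof.
rewrite /dihedral_coef -/m -/th; case: eqP => // /eqP m0.
by rewrite mulr1n divff// gt_eqF// sth.
Qed.

Lemma act_altV k : act (alt C t s k)^-1%g (alpha s) =
  dihedral_coef s t k.+1 *: alpha (alt_letter s t k) +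
  dihedral_coef s t k *: alpha (alt_letter t s k).
Proof.
elim: k => [|k IH].
  by rewrite invg1 act1 dihedral_coef0 dihedral_coef1 scale0r scale1r addr0.
rewrite altSr invgM cox_genV actM IH !alt_letterS actD !actZ act_gen_simple.
rewrite act_gen /simple_refl form_simple dihedral_coefSS.
have -> : gram R C (alt_letter s t k) (alt_letter t s k) = gram R C s t.
  by rewrite /alt_letter; case: odd => //; rewrite gramC.
by apply/ffunP => i; rewrite !ffunE /GRing.scale /=; ring.
Qed.

End Dihedral.

(* For a left descent [t] of [w], split off the longest alternating prefix    *)
(* tst...: the cofactor [v] has neither [s] nor [t] as a left descent, and    *)
(* the dihedral coefficients are nonnegative since the prefix is shorter than *)
(* m(s,t), as otherwise it could be rewritten to start with [s].              *)
Lemma act_nonneg w s :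
  (ell w <= ell (gen s * w)%g)%N -> nonneg (act w^-1%g (alpha s)).
Proof.
have [n] := ubnP (ell w); elim: n w s => // n IH w s wn sw.
have [->|/eqP w1] := eqVneq w 1%g.
  by rewrite invg1 act1; exact: nonneg_simple.
have [t tw] := exists_left_descent C w1.
have st : s != t by apply/eqP => e; subst t; lia.
pose P k := (0 < k)%N && (ell w == k + ell ((alt C t s k)^-1 * w)%g)%N.
have exP : exists k, P k by exists 1%N; rewrite /P /= mulg1 cox_genV tw add1n.
have ubP k : P k -> (k <= ell w)%N by move=> /andP[_ /eqP]; lia.
case: (ex_maxnP exP ubP) => k /andP[k0 /eqP] kE kmax.
set v := (_ * w)%g in kE.
have wE : w = (alt C t s k * v)%g by rewrite /v mulVKg.
have next : nonneg (act v^-1%g (alpha (alt_letter t s k))).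
  apply: IH; first by lia.
  rewrite leqNgt; apply/negP => lt_v.
  have le_v := cox_length_le_genM C (alt_letter t s k) v.
  suff /kmax : P k.+1 by lia.
  rewrite /P altSrV_mul -/v; apply/andP; split => //.
  by apply/eqP; lia.
have prev : nonneg (act v^-1%g (alpha (alt_letter s t k))).
  apply: IH; first by lia.
  rewrite leqNgt; apply/negP => lt_v.
  have := cox_lengthM C (alt C t s k.-1) (gen (alt_letter s t k) * v).
  have := cox_length_alt C t s k.-1.
  suff -> : (alt C t s k.-1 * (gen (alt_letter s t k) * v))%g = w by lia.
  clearbody v; clear -k0 wE; case: k k0 wE => // k _ wE.
  by rewrite wE alt_letterS altSr mulgA.
have km : cox_m C s t = 0%N \/ (k < cox_m C s t)%N.
  have [|mk] := ltnP k (cox_m C s t); [by right | left].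
  case mE : (cox_m C s t) => [//|m]; exfalso.
  have tsk := altD C t s m.+1 (k - m.+1).
  rewrite subnKC -mE // -alt_braid mE /= in tsk.
  set h := alt _ _ _ (k - m.+1) in tsk.
  have swE : (gen s * w = alt C t s m * (h * v))%g.
    by rewrite wE tsk -!mulgA cox_genK.
  have hk : (ell h <= k - m.+1)%N by exact: cox_length_alt.
  have := cox_lengthM C (alt C t s m) (h * v).
  have := cox_lengthM C h v; have := cox_length_alt C t s m.
  by rewrite mE in mk; rewrite swE in sw; lia.
rewrite wE invgM actM act_altV// actD !actZ.
by apply: nonneg_comb => //; apply: dihedral_coef_ge0 => //; lia.
Qed.

Lemma act_nonpos w s :
  (ell (gen s * w)%g < ell w)%N -> nonneg (- act w^-1%g (alpha s)).
Proof.
move=> sw; rewrite -actN -act_gen_simple -actV_genM; apply: act_nonneg.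
by rewrite cox_genK ltnW.
Qed.

Lemma root_nonneg g : roots g -> nonneg g \/ nonneg (- g).
Proof.
move=> [w [s ->]]; rewrite -(invgK w).
have [|] := leqP (ell w^-1%g) (ell (gen s * w^-1)%g).
  by left; exact: act_nonneg.
by right; exact: act_nonpos.
Qed.

(** Only 0 has both signs, while roots have norm 1. *)
Lemma root_not_both g : roots g -> nonneg g -> ~ nonneg (- g).
Proof.
move=> /form_root g1 g0 gN0.
have g_eq0 : g = 0.
  apply/ffunP => s; apply/eqP; rewrite ffunE eq_le g0 andbT.
  by have := gN0 s; rewrite ffunE oppr_ge0.
move: g1; rewrite g_eq0 -(scale0r 0) formZl mul0r => /esym/eqP.
by rewrite oner_eq0.
Qed.

(** The reflection changes only coordinate [s]. If the image is non-positive, all other coordinates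
    of [g] vanish, and norm 1 leaves only [alpha s]. *)
Lemma simple_refl_nonneg g s :
  roots g -> nonneg g -> g <> alpha s -> nonneg (act (gen s) g).
Proof.
move=> rg g0 gs; have [//|sgN] := root_nonneg (roots_act (gen s) rg).
have g_eq t : t != s -> g t = 0.
  move=> ts; apply/eqP; rewrite eq_le g0 andbT.
  have := sgN t; rewrite act_gen !ffunE (negPf ts) scaler0 subr0.
  by rewrite oppr_ge0.
have gE : g = g s *: alpha s.
  apply/ffunP => t; rewrite !ffunE; have [->|ts] := eqVneq t s.
    by rewrite /GRing.scale /= mulr1.
  by rewrite scaler0 g_eq.
have /eqP := form_root rg.
rewrite gE formZl form_scaler form_simple gramss mulr1 -expr2 sqrf_eq1.
have gs0 := g0 s.
case/orP => /eqP e; first by case: gs; rewrite gE e scale1r.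
by move: gs0; rewrite e oppr_ge0 ler10.
Qed.

(** The alternating prefix is extended letter by letter. If this stops early, the cofactor has
    neither [s] nor [t] as a left descent, which makes w^-1 alpha_t non-negative, although [t] is a
    left descent of [w]. *)
Lemma left_descents_alt s t w : s != t ->
  (ell (gen s * w)%g < ell w)%N -> (ell (gen t * w)%g < ell w)%N ->
  forall k, cox_m C s t = 0%N \/ (k <= cox_m C s t)%N ->
  ell w = (k + ell ((alt C s t k)^-1 * w)%g)%N.
Proof.
move=> st sw tw; elim=> [|k IH] km; first by rewrite invg1 mul1g.
case: k km IH => [|k] km IH.
  have := cox_length_le_genM C s w.
  have -> : ((alt C s t 1)^-1 * w = gen s * w)%g by rewrite /= mulg1 cox_genV.
  by lia.
have {}IH := IH ltac:(lia).
rewrite altSrV_mul.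
set v := (_ * w)%g in IH *.
have wE : w = (alt C s t k.+1 * v)%g by rewrite /v mulVKg.
have [lt_v|ge_v] := ltnP (ell (gen (alt_letter s t k.+1) * v)%g) (ell v).
  by have := cox_length_le_genM C (alt_letter s t k.+1) v; lia.
have prev : (ell v <= ell (gen (alt_letter t s k.+1) * v)%g)%N.
  rewrite leqNgt alt_letterS; apply/negP => lt_v.
  have := cox_lengthM C (alt C s t k) (gen (alt_letter s t k) * v).
  have := cox_length_alt C s t k.
  by rewrite mulgA -altSr -wE; lia.
exfalso; apply: (root_not_both _ _ (act_nonpos tw)).
  exact/roots_act/roots_simple.
rewrite wE invgM actM act_altV 1?eq_sym// actD !actZ.
by apply: nonneg_comb; try exact: act_nonneg;
  apply: dihedral_coef_ge0; rewrite 1?eq_sym// cox_m_sym; lia.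
Qed.

(** * Inversion sets and left multiplication by a generator *)

Lemma inversionsP w g :
  Phi w g <-> [/\ roots g, nonneg g & nonneg (- act w^-1%g g)].
Proof.
split=> [[[rg g0] [_ wg]]|[rg g0 wg]].
  by split=> // s; rewrite ffunE oppr_ge0.
split; split=> // [|s]; first exact: roots_act.
by have := wg s; rewrite ffunE oppr_ge0.
Qed.

Lemma inversions_root w g : Phi w g -> roots g.
Proof. by case/inversionsP. Qed.

Lemma inversions_nonneg w g : Phi w g -> nonneg g.
Proof. by case/inversionsP. Qed.

Lemma not_inversions w g : roots g -> nonneg g -> ~ Phi w g ->
  nonneg (act w^-1%g g).
Proof.
move=> rg g0 wg; have [//|wg'] := root_nonneg (roots_act w^-1%g rg).
by case: wg; apply/inversionsP.
Qed.

Lemma nonneg_act_not_inversions w g : nonneg (act w^-1%g g) -> ~ Phi w g.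
Proof.
move=> wg0 /inversionsP[rg _]; apply: root_not_both wg0; exact: roots_act.
Qed.

Lemma inversions_simple w s :
  Phi w (alpha s) <-> (ell (gen s * w)%g < ell w)%N.
Proof.
split=> [ws|sw].
  rewrite ltnNge; apply/negP => /act_nonneg ?.
  exact: nonneg_act_not_inversions ws.
apply/inversionsP; split; [exact: roots_simple|exact: nonneg_simple|].
exact: act_nonpos.
Qed.

Lemma inversions_genM_simple w s :
  ~ Phi w (alpha s) -> Phi (gen s * w)%g (alpha s).
Proof.
move=> ws; apply/inversionsP.
split; [exact: roots_simple|exact: nonneg_simple|].
rewrite actV_genM act_gen_simple actN opprK.
by apply: not_inversions; [exact: roots_simple|exact: nonneg_simple|].
Qed.

Lemma inversions_simple_length w s :
  Phi w (alpha s) -> ell w = (ell (gen s * w)%g).+1.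
Proof. by move/inversions_simple; have := cox_length_le_genM C s w; lia. Qed.

Lemma not_inversions_simple_length w s :
  ~ Phi w (alpha s) -> ell (gen s * w)%g = (ell w).+1.
Proof.
by move/inversions_genM_simple/inversions_simple_length; rewrite cox_genK.
Qed.

Lemma not_inversions_genM_simple w s :
  Phi w (alpha s) -> ~ Phi (gen s * w)%g (alpha s).
Proof.
by rewrite !inversions_simple cox_genK; lia.
Qed.

Lemma inversions_genM w s g : roots g -> nonneg g -> g <> alpha s ->
  Phi (gen s * w)%g g <-> Phi w (act (gen s) g).
Proof.
move=> rg g0 gs; rewrite !inversionsP actV_genM; split=> [[_ _ h]|[_ _ h]].
  by split=> //; [exact: roots_act|exact: simple_refl_nonneg].
by [].
Qed.

(** * The weak order: prefixes, bounds and meets *)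

Local Notation "a <=W b" := (Phi a `<=` Phi b) (at level 70).

Lemma inversions1 g : ~ Phi 1%g g.
Proof.
by move=> /inversionsP[rg g0]; rewrite invg1 act1; exact: root_not_both.
Qed.

Lemma weak_le1 w : 1%g <=W w.
Proof. by move=> g /inversions1. Qed.

(** Away from alpha_s, left multiplication by [s] reflects inversions. It toggles alpha_s itself,
    and the hypothesis keeps that root from ending up on the left side only. *)
Lemma weak_le_genM s a b : (Phi b (alpha s) -> Phi a (alpha s)) ->
  a <=W b -> (gen s * a)%g <=W (gen s * b)%g.
Proof.
move=> ba ab g sag.
have [rg g0] := (inversions_root sag, inversions_nonneg sag).
have [gs|gs] := pselect (g = alpha s); last first.
  by apply/inversions_genM => //; apply/ab/inversions_genM.
rewrite gs in sag *; apply: inversions_genM_simple => /ba.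
by move/not_inversions_genM_simple.
Qed.

Lemma weak_le_length a b : a <=W b -> ell b = (ell a + ell (a^-1 * b)%g)%N.
Proof.
move: a b; apply: (cox_length_ind (C := C)) => [b _|s a sa IH b sab].
  by rewrite cox_length1 invg1 mul1g.
have sas : Phi (gen s * a)%g (alpha s).
  by apply/inversions_simple; rewrite cox_genK sa.
have ab : a <=W (gen s * b)%g.
  by rewrite -(cox_genK C s a); apply: weak_le_genM.
rewrite (inversions_simple_length (sab _ sas)) sa (IH _ ab) addSn.
by rewrite invgM cox_genV mulgA.
Qed.

Lemma length_weak_le a b : ell b = (ell a + ell (a^-1 * b)%g)%N -> a <=W b.
Proof.
move: a b; apply: (cox_length_ind (C := C)) => [b _|s a sa IH b].
  exact: weak_le1.
have -> : ((gen s * a)^-1 * b = a^-1 * (gen s * b))%g.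
  by rewrite invgM cox_genV mulgA.
move=> bE; have sb : (ell (gen s * b)%g < ell b)%N.
  have := cox_lengthM C a (a^-1 * (gen s * b)); rewrite mulVKg.
  by lia.
have sbs : Phi b (alpha s) by exact/inversions_simple.
have ab : a <=W (gen s * b)%g.
  by apply: IH; have := inversions_simple_length sbs; lia.
have := weak_le_genM (s := s) _ ab; rewrite cox_genK; apply.
by move/not_inversions_genM_simple; rewrite cox_genK.
Qed.

Lemma weak_le_eq a b : a <=W b -> (ell b <= ell a)%N -> a = b.
Proof.
move=> /weak_le_length bE ba.
have /cox_length0_eq1 e : ell (a^-1 * b)%g = 0%N by lia.
by rewrite -[RHS](mulVKg a) e mulg1.
Qed.

Lemma weak_le_length_le a b : a <=W b -> (ell a <= ell b)%N.
Proof. by move/weak_le_length ->; exact: leq_addr. Qed.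

Lemma dihedral_join s t w : s != t -> Phi w (alpha s) -> Phi w (alpha t) ->
  let d := alt C s t (cox_m C s t) in
  [/\ Phi d (alpha s), Phi d (alpha t) & d <=W w].
Proof.
move=> st /inversions_simple ws /inversions_simple wt d.
have wE := left_descents_alt st ws wt.
have m0 : cox_m C s t <> 0%N.
  by move=> m0; have := wE (ell w).+1 (or_introl m0); lia.
have {}wE := wE (cox_m C s t) (or_intror (leqnn _)).
have dm : ell d = cox_m C s t.
  have := cox_length_alt C s t (cox_m C s t).
  by have := cox_lengthM C d (d^-1 * w); rewrite mulVKg /d; lia.
have desc x y : d = alt C x y (cox_m C s t) -> Phi d (alpha x).
  move=> dE; apply/inversions_simple; rewrite dm dE.
  case: (cox_m C s t) m0 => // m _; rewrite /= cox_genK ltnS.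
  exact: cox_length_alt.
split; [exact: desc|by apply: desc; exact: alt_braid|].
by apply: length_weak_le; rewrite dm.
Qed.

(* If [a] and [b] start with distinct letters [s] and [t], the longest        *)
(* element of <s, t> lies below [u] and [v]; it is first joined with [a]      *)
(* after cancelling [s], and the result with [b] after cancelling [t].        *)
Lemma weak_lower_bounds_directed (u v a b : W) :
  a <=W u -> a <=W v -> b <=W u -> b <=W v ->
  exists c, [/\ a <=W c, b <=W c, c <=W u & c <=W v].
Proof.
have [n] := ubnP (ell u); elim: n u v a b => // n IH u v a b un au av bu bv.
have share s a' b' : Phi a' (alpha s) -> Phi b' (alpha s) ->
    a' <=W u -> a' <=W v -> b' <=W u -> b' <=W v ->
    exists c, [/\ a' <=W c, b' <=W c, c <=W u & c <=W v].
  move=> as_ bs au' av' bu' bv'.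
  have us := au' _ as_; have vs := av' _ as_.
  have [||||| c [ac bc cu cv]] :=
    IH (gen s * u)%g (gen s * v)%g (gen s * a')%g (gen s * b')%g.
  - by have := inversions_simple_length us; lia.
  - exact: weak_le_genM.
  - exact: weak_le_genM.
  - exact: weak_le_genM.
  - exact: weak_le_genM.
  have ncs : ~ Phi c (alpha s).
    by move/cu/not_inversions_genM_simple; rewrite cox_genK.
  exists (gen s * c)%g; split.
  - by rewrite -(cox_genK C s a'); apply: weak_le_genM.
  - by rewrite -(cox_genK C s b'); apply: weak_le_genM.
  - rewrite -(cox_genK C s u); apply: weak_le_genM => //.
    by move/not_inversions_genM_simple; rewrite cox_genK.
  - rewrite -(cox_genK C s v); apply: weak_le_genM => //.
    by move/not_inversions_genM_simple; rewrite cox_genK.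
have desc w : w <> 1%g -> exists s, Phi w (alpha s).
  move=> /(exists_left_descent C)[s sw]; exists s.
  by apply/inversions_simple; rewrite sw.
have [->|/eqP/desc[s as_]] := eqVneq a 1%g.
  by exists b; split=> //; exact: weak_le1.
have [->|/eqP/desc[t bt]] := eqVneq b 1%g.
  by exists a; split=> //; exact: weak_le1.
have [st|st] := eqVneq s t; first by apply: (share s) => //; rewrite st.
have [ds dt du] := dihedral_join st (au _ as_) (bu _ bt).
have [_ _ dv] := dihedral_join st (av _ as_) (bv _ bt).
have [c [ac dc cu cv]] := share s _ _ as_ ds au av du dv.
have [e [ce be eu ev]] := share t _ _ (dc _ dt) bt cu cv bu bv.
by exists e; split=> //; exact: subset_trans ce.
Qed.

(** The meet is a longest common lower bound above [a]: by directedness it has an upper bound with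
    any other [b] that is still below [u] and [v], and maximality makes the two equal. *)
Lemma weak_meet (u v a : W) : a <=W u -> a <=W v ->
  exists m, [/\ a <=W m, m <=W u, m <=W v &
    forall b, b <=W u -> b <=W v -> b <=W m].
Proof.
move=> au av.
pose P n := `[< exists c, [/\ a <=W c, c <=W u, c <=W v & ell c = n] >].
have exP : exists n, P n by exists (ell a); apply/asboolP; exists a; split.
have ubP n : P n -> (n <= ell u)%N.
  by move=> /asboolP[c [_ cu _ <-]]; exact: weak_le_length_le.
case: (ex_maxnP exP ubP) => n /asboolP[m [am mu mv mn]] nmax.
exists m; split=> // b bu bv.
have [c [mc bc cu cv]] := weak_lower_bounds_directed mu mv bu bv.
suff -> : m = c by [].
apply: weak_le_eq => //; rewrite mn; apply: nmax; apply/asboolP.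
by exists c; split=> //; exact: subset_trans mc.
Qed.

(** * Inversions as last letters of prefixes, and semidistributivity *)

Lemma inversions_mul_gen a s g : nonneg (act a (alpha s)) ->
  Phi (a * gen s)%g g <-> Phi a g \/ g = act a (alpha s).
Proof.
move=> as0.
have actVM : act (a * gen s)^-1%g g = act (gen s) (act a^-1%g g).
  by rewrite invgM actM cox_genV.
have ras := roots_act a (roots_simple s).
have [gE|gas] := pselect (g = act a (alpha s)).
  split=> [_|_]; [by right|apply/inversionsP]; rewrite actVM gE actK.
  by rewrite act_gen_simple opprK; split=> //; exact: nonneg_simple.
split=> [/inversionsP[rg g0]|[/inversionsP[rg g0 ag0]|//]].
  rewrite actVM => sag0; left; apply/inversionsP; split=> //.
  rewrite -(simple_actK s (act _ g)) -actN; apply: simple_refl_nonneg => //.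
    by apply/rootsN/roots_act/roots_act.
  move=> /(congr1 (act (gen s))); rewrite actN simple_actK act_gen_simple.
  by move=> /oppr_inj agE; apply: gas; rewrite -agE actVK.
apply/inversionsP; split=> //; rewrite actVM -actN.
apply: simple_refl_nonneg => //; first exact/rootsN/roots_act.
move=> agE; apply: (root_not_both ras as0).
by rewrite -agE actN actVK opprK.
Qed.

(** The inversions of a reduced word s_1 ... s_n are the roots s_1 ... s_{i-1} alpha_{s_i}. *)
Lemma inversion_of_prefix x g : Phi x g ->
  exists a s, g = act a (alpha s) /\ a <=W x.
Proof.
move: x g; apply: (cox_length_ind (C := C)).
  by move=> g /inversions1.
move=> s x sx IH g xg.
have [->|gs] := pselect (g = alpha s).
  by exists 1%g, s; rewrite act1; split=> //; exact: weak_le1.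
have [rg g0] := (inversions_root xg, inversions_nonneg xg).
have /IH[a [t [gE ax]]] : Phi x (act (gen s) g) by exact/inversions_genM.
exists (gen s * a)%g, t; split.
  by rewrite actM -gE -actM cox_gen2 act1.
apply: weak_le_genM => // /inversions_simple; lia.
Qed.

(** Both sides act on V in the same way, as reflections are conjugated by [w]; elements with equal
    inversion sets are equal. *)
Lemma gen_conj w s r :
  act w (alpha s) = alpha r -> (gen r * w = w * gen s)%g.
Proof.
move=> ws.
have actE g : act (gen r * w)^-1%g g = act (w * gen s)^-1%g g.
  rewrite actV_genM invgM actM cox_genV !act_gen /simple_refl.
  rewrite -[form (act _ g) _](form_act w) actVK ws.
  by rewrite -!scaleNr actD actZ -ws actK.
have PhiE : Phi (gen r * w)%g = Phi (w * gen s)%g.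
  by rewrite predeqE => g; rewrite !inversionsP actE.
by apply: weak_le_eq; rewrite ?PhiE//; apply: weak_le_length_le; rewrite PhiE.
Qed.

(** If [g] is an inversion of a^-1, then -a g is one of [a], hence not of [b], so b^-1 a g is
    non-positive. *)
Lemma disjoint_weak_le a b : (forall g, Phi a g -> ~ Phi b g) ->
  a^-1%g <=W (a^-1 * b)%g.
Proof.
move=> ab g /inversionsP[rg g0]; rewrite invgK => ag0.
have rag := rootsN (roots_act a rg).
have /ab bag : Phi a (- act a g).
  by apply/inversionsP; split=> //; rewrite actN actK opprK.
apply/inversionsP; split=> //.
by rewrite invgM invgK actM -actN; exact: not_inversions.
Qed.

(** The sign of a^-1 g decides: if positive, it is an inversion of [m], hence of a^-1 b; if
    negative, its opposite is an inversion of a^-1, hence of [m], which contradicts the sign of m^-1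
    a^-1 g. *)
Lemma weak_le_mulK a b m :
  a^-1%g <=W m -> m <=W (a^-1 * b)%g -> (a * m)%g <=W b.
Proof.
move=> am mb g /inversionsP[rg g0]; rewrite invgM actM => mg0.
have rag := roots_act a^-1%g rg; have rmg := roots_act m^-1%g rag.
have [ag0|ag0] := root_nonneg rag.
  have /mb /inversionsP[_ _] : Phi m (act a^-1%g g) by exact/inversionsP.
  by rewrite invgM invgK actM actVK => bg0; apply/inversionsP.
have /am /inversionsP[_ _] : Phi a^-1%g (- act a^-1%g g).
  apply/inversionsP; split=> //; first exact: rootsN.
  by rewrite invgK actN actVK opprK.
by rewrite actN opprK => /(root_not_both rmg).
Qed.

(* As [gen r * u = u * gen s] covers [u], and similarly for [v], both [m] and *)
(* [gen r * m] are common lower bounds of [gen r * u] and [gen r * v].  An    *)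
(* upper bound [n] of the two among these satisfies [gen r * n <= m], whence  *)
(* [m <= n <= gen r * m], and the last letter of that cover is the desired    *)
(* [p].                                                                       *)
Lemma meet_gen_conj (u v m : W) r s t :
  act u (alpha s) = alpha r -> act v (alpha t) = alpha r ->
  m <=W u -> m <=W v -> (forall b, b <=W u -> b <=W v -> b <=W m) ->
  exists p, act m (alpha p) = alpha r.
Proof.
move=> us vt mu mv mmax.
have up (w : W) q : act w (alpha q) = alpha r -> w <=W (gen r * w)%g.
  move=> wq; rewrite (gen_conj wq) => g wg.
  by apply/inversions_mul_gen; [rewrite wq; exact: nonneg_simple|left].
have mr : ~ Phi m (alpha r).
  move/mu; apply: nonneg_act_not_inversions.
  by rewrite -us actK; exact: nonneg_simple.
have mr' : Phi (gen r * m)%g (alpha r) by exact: inversions_genM_simple.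
have down (w c : W) : Phi c (alpha r) -> c <=W (gen r * w)%g ->
    (gen r * c)%g <=W w.
  by move=> cr cw; rewrite -(cox_genK C r w); exact: weak_le_genM.
have lift (w : W) q : act w (alpha q) = alpha r -> m <=W w ->
    (gen r * m)%g <=W (gen r * w)%g.
  move=> wq mw; apply: weak_le_genM => // wr; exfalso; move: wr.
  by apply: nonneg_act_not_inversions; rewrite -wq actK; exact: nonneg_simple.
have [n [mn rmn nu nv]] := weak_lower_bounds_directed
  (subset_trans mu (up _ _ us)) (subset_trans mv (up _ _ vt))
  (lift _ _ us mu) (lift _ _ vt mv).
have nr : Phi n (alpha r) by exact: rmn.
have rnm : (gen r * n)%g <=W m by apply: mmax; exact: down.
have nrm : n <=W (gen r * m)%g.
  by rewrite -(cox_genK C r n); apply: weak_le_genM.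
have mrm := subset_trans mn nrm.
have q1 : ell (m^-1 * (gen r * m))%g = 1%N.
  have := weak_le_length mrm.
  by rewrite (not_inversions_simple_length mr); lia.
have /(exists_left_descent C)[p] : (m^-1 * (gen r * m) <> 1)%g.
  by move=> e; rewrite e cox_length1 in q1.
rewrite q1 => -[/esym/cox_length0_eq1 pq1].
have rm_mp : (gen r * m = m * gen p)%g.
  by rewrite -(mulVKg m (gen r * m)%g) -(cox_genK C p (_^-1 * _)%g) pq1 mulg1.
exists p; apply: contrapT => mpr.
have rmp := roots_act m (roots_simple p).
have mp0 : nonneg (act m (alpha p)).
  have [//|mpN] := root_nonneg rmp.
  have /mrm /inversionsP[_ _] : Phi m (- act m (alpha p)).
    apply/inversionsP; split=> //; first exact: rootsN.
    by rewrite actN actK opprK; exact: nonneg_simple.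
  rewrite rm_mp invgM actM cox_genV !actN actK act_gen_simple opprK.
  by move/(root_not_both (roots_simple p) (@nonneg_simple p)).
(* A positive root other than alpha_r stays positive under r, but r m alpha_p = m p alpha_p = -m
   alpha_p. *)
have := simple_refl_nonneg rmp mp0 mpr.
rewrite -actM rm_mp actM act_gen_simple actN.
exact: root_not_both.
Qed.

Lemma common_prefix_to_root (a y z : W) r s t :
  nonneg (act a (alpha r)) ->
  act y (alpha s) = act a (alpha r) -> act z (alpha t) = act a (alpha r) ->
  (forall g, Phi a g -> ~ Phi y g) -> (forall g, Phi a g -> ~ Phi z g) ->
  exists m p, [/\ act m (alpha p) = act a (alpha r), m <=W y & m <=W z].
Proof.
move=> ar0 yE zE ay az.
have [m [am my mz mmax]] :=
  weak_meet (disjoint_weak_le ay) (disjoint_weak_le az).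
have [||p mp] := @meet_gen_conj _ _ m r s t _ _ my mz mmax.
- by rewrite actM yE actK.
- by rewrite actM zE actK.
by exists (a * m)%g, p; split; [rewrite actM mp|exact: weak_le_mulK..].
Qed.

Lemma intersection_set1_directed (x : W) g (y z : W) : Phi x g ->
  Phi x `&` Phi y = [set g] -> Phi x `&` Phi z = [set g] ->
  exists w, [/\ Phi x `&` Phi w = [set g], w <=W y & w <=W z].
Proof.
move=> xg xy xz.
have g0 := inversions_nonneg xg.
have [a [r [gE ax]]] := inversion_of_prefix xg.
have prefix (w : W) : Phi x `&` Phi w = [set g] -> exists b s,
    [/\ act b (alpha s) = g, b <=W w & forall d, Phi a d -> ~ Phi b d].
  move=> xw; have [_ wg] : (Phi x `&` Phi w) g by rewrite xw.
  have [b [s [gE' bw]]] := inversion_of_prefix wg.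
  exists b, s; split=> // d ad bd.
  have : (Phi x `&` Phi w) d by split; [exact: ax|exact: bw].
  (* The only candidate is [g], which [b] does not invert because b^-1 g = alpha_s. *)
  rewrite xw => /= dg; move: bd; apply: nonneg_act_not_inversions.
  by rewrite dg gE' actK; exact: nonneg_simple.
have [y' [s [ys y'y ay]]] := prefix _ xy.
have [z' [t [zt z'z az]]] := prefix _ xz.
rewrite gE in ys zt.
have [|m [p [mp my mz]]] := common_prefix_to_root _ ys zt ay az.
  by rewrite -gE.
rewrite -gE in mp.
have mp0 : nonneg (act m (alpha p)) by rewrite mp.
(* Right multiplication of [m] by p adds only the inversion [g], which [w] has anyway. *)
have below (w c : W) : Phi x `&` Phi w = [set g] -> m <=W c -> c <=W w ->
    (m * gen p)%g <=W w.
  move=> xw mc cw d /(inversions_mul_gen _ mp0)[/mc/cw//|->].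
  by rewrite mp; have [] : (Phi x `&` Phi w) g by rewrite xw.
exists (m * gen p)%g; split; [|exact: below xy my y'y|exact: below xz mz z'z].
apply/seteqP; split=> d /=.
  move=> [xd /(below _ _ xy my y'y) yd].
  by have : (Phi x `&` Phi y) d by []; rewrite xy.
by move=> ->; split=> //; apply/inversions_mul_gen => //; right.
Qed.

End RootSystem.

Theorem theorem1 (R : realType) (W : groupType) (S : finType)
    (C : coxeter_system W S) (x : W) (beta : {ffun S -> R^o})
    (hbeta : inversions C x beta)
    (hex : exists y : W,
      inversions C x `&` inversions C y = [set beta]) :
  exists! ybeta : W,
    inversions C x `&` inversions C ybeta = [set beta] /\
    (forall y : W, inversions C x `&` inversions C y = [set beta] ->
      cox_length C ybeta <= cox_length C y).
Proof.
pose P n := `[< exists y, inversions C x `&` inversions C y = [set beta] /\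
  cox_length C y = n >].
have exP : exists n, P n.
  by case: hex => y xy; exists (cox_length C y); apply/asboolP; exists y.
case: (ex_minnP exP) => n /asboolP[y [xy yn]] nmin.
have ymin z : inversions C x `&` inversions C z = [set beta] ->
    cox_length C y <= cox_length C z.
  by move=> xz; rewrite yn; apply: nmin; apply/asboolP; exists z.
exists y; split=> // z [xz zmin].
have [w [xw wy wz]] := intersection_set1_directed hbeta xy xz.
have <- : w = y by apply: (weak_le_eq wy); exact: ymin.
by apply: (weak_le_eq wz); exact: zmin.
Qed.
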